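(* Let $q\ge 3$ and $l\ge 1$ be integers, let $W$ be a linear subspace of the space of real $l\times q$ matrices, and let $\nu\in\mathfrak{W}$ be a finite $\mathbb{R}^l$-valued measure on $\mathbb{T}$, i.e. a finite $\mathbb{R}^l$-valued measure with $\mathrm{Diff}(\nu)\subset W$. Then $$\frac{d\nu}{d|\nu|}(x)\in\Lambda(W)\qquad\text{for } |\nu_s|\text{-almost every } x\in\mathbb{T}.$$
   Context: Tree and path space. Fix an integer $q\ge 3$. Let $\mathcal{T}$ be the infinite $q$-regular rooted directed tree: it is connected, has no cycles, each vertex has exactly $q$ outgoing edges, each vertex except the root has exactly one incoming edge, and the root has none. If $v\to w$ then $w$ is called a son of $v$; for each vertex an enumeration of its sons by $1,\dots,q$ is fixed. $\mathbb{T}$ is the set of all infinite directed paths $x=(x(0),x(1),x(2),\dots)$ in $\mathcal{T}$ with $x(0)$ the root and each $x(n+1)$ a son of $x(n)$. For a vertex $v$ at graph distance $n$ from the root put $\omega_v=\{x\in\mathbb{T}: x(n)=v\}$; these $q^n$ sets are the atoms of generation $n$, and $\mathcal{AF}_n$ denotes the set of them, a partition of $\mathbb{T}$. $\mathcal{F}_n$ is the (finite) set algebra generated by $\mathcal{AF}_n$. The sons of the atom $\omega_v$ are the atoms $\omega_w$ with $w$ a son of $v$, with the same enumeration $\omega_1,\dots,\omega_q$. $\mathbb{T}$ carries the $\sigma$-algebra $\sigma(\bigcup_n\mathcal{F}_n)$ and the uniform probability measure $\mu$, $\mu(\omega)=q^{-n}$ for $\omega\in\mathcal{AF}_n$. Measures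 and differences. $\mathrm{M}(\mathbb{T},\mathbb{R}^l)$ is the set of finite $\mathbb{R}^l$-valued (countably additive) measures on $\mathbb{T}$. For $\nu\in\mathrm{M}(\mathbb{T},\mathbb{R}^l)$ let $\nu_n$ be the function $\nu_n(x)=q^n\nu(\omega)$ for $x\in\omega\in\mathcal{AF}_n$; write $\nu_n(\omega)$ for its constant value on $\omega\in\mathcal{AF}_n$. For $\omega\in\mathcal{AF}_n$ with sons $\omega_1,\dots,\omega_q\in\mathcal{AF}_{n+1}$, let $D_\omega$ be the real $l\times q$ matrix whose columns are $d_i=\nu_{n+1}(\omega_i)-\nu_n(\omega)\in\mathbb{R}^l$, $i=1,\dots,q$. $\mathrm{Diff}(\nu)$ is the set of all matrices $D_\omega$, over all atoms $\omega$ of all generations $n\ge 0$. The space $\mathfrak{W}$ and the wave cone. For a linear subspace $W$ of the real $l\times q$ matrices, $\mathfrak{W}=\{\nu\in\mathrm{M}(\mathbb{T},\mathbb{R}^l): \mathrm{Diff}(\nu)\subset W\}$. Let $\mathbb{R}^q_0=\{w\in\mathbb{R}^q:\sum_{j=1}^q w_j=0\}$ and $v\otimes w=v w^{t}$ for $v\in\mathbb{R}^l$, $w\in\mathbb{R}^q$. The martingale wave cone of $W$ is $$\Lambda(W)=\{v\in\mathbb{R}^l:\ \exists\, w\in\mathbb{R}^q_0\setminus\{0\}\ \text{such that}\ v\otimes w\in W\}.$$ Other notation. $\nu=\nu_{abs}+\nu_s$ is the Lebesgue decomposition of $\nu$ into absolutely continuous and singular parts with respect to $\mu$; $|\cdot|$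 denotes total variation measure (with respect to the Euclidean norm on $\mathbb{R}^l$); $\frac{d\nu}{d|\nu|}$ is the Radon–Nikodym derivative of $\nu$ with respect to $|\nu|$. *)

(* Defs.v *)
From HB Require Import structures.
From mathcomp Require Import all_boot all_order all_algebra.
From mathcomp Require Import ring.
From mathcomp Require Import all_classical all_reals all_analysis.

Set Implicit Arguments.
Unset Strict Implicit.
Unset Printing Implicit Defensive.

Import Order.TTheory GRing.Theory Num.Theory.
Import numFieldNormedType.Exports.

Local Open Scope classical_set_scope.
Local Open Scope ring_scope.
Local Open Scope charge_scope.

Section euclidean_norm.
Context {R : realType} {l : nat}.
Implicit Types u v : 'cV[R]_l.

Definition enorm v : R := Num.sqrt (\sum_i v i 0 ^+ 2).

Lemma enorm_ge0 v : 0 <= enorm v.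
Proof. exact: sqrtr_ge0. Qed.

Lemma enorm_sq v : enorm v ^+ 2 = \sum_i v i 0 ^+ 2.
Proof. by rewrite sqr_sqrtr// sumr_ge0// => i _; rewrite sqr_ge0. Qed.

Lemma dot_le_enorm u v : \sum_i u i 0 ^+ 2 = 1 ->
  \sum_i u i 0 * v i 0 <= enorm v.
Proof.
move=> u1; set c := \sum_i _.
have [c0|c0] := leP c 0; first exact: le_trans c0 (enorm_ge0 v).
rewrite -(@ler_pXn2r _ 2)// ?nnegrE ?enorm_ge0 ?(ltW c0)// enorm_sq -subr_ge0.
suff -> : \sum_i v i 0 ^+ 2 - c ^+ 2 = \sum_i (v i 0 - c * u i 0) ^+ 2.
  by rewrite sumr_ge0// => i _; rewrite sqr_ge0.
transitivity (\sum_i (v i 0 ^+ 2 - c * (u i 0 * v i 0) *+ 2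
                      + c ^+ 2 * u i 0 ^+ 2)).
  rewrite big_split/= sumrB -mulr_sumr u1 mulr1 sumrMnl -mulr_sumr -/c.
  by rewrite -expr2 mulr2n opprD addrA subrK.
by apply: eq_bigr => i _; ring.
Qed.

Lemma enorm_le_sum v : enorm v <= \sum_i `|v i 0|.
Proof.
have s0 : 0 <= \sum_i `|v i 0| by rewrite sumr_ge0.
rewrite -(@ler_pXn2r _ 2)// ?nnegrE ?enorm_ge0// enorm_sq expr2 mulr_suml.
apply: ler_sum => i _; rewrite -real_normK ?num_real// expr2.
by rewrite ler_wpM2l// (bigD1 i)//= lerDl sumr_ge0.
Qed.

End euclidean_norm.

(* An R^l-valued measure is given by its l components, which are finite signed
   measures; countable additivity in R^l is componentwise. *)
Definition vmeasure d (T : measurableType d) (R : realType) (l : nat) :=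
  'I_l -> {charge set T -> \bar R}.

Section vector_measure.
Context d (T : measurableType d) (R : realType) (l : nat).
Implicit Types (nu : vmeasure T R l) (A : set T).

Definition vval nu A : 'cV[R]_l := \col_i fine (nu i A).

Definition disjoint_family A n (E : nat -> set T) :=
  [/\ forall k, measurable (E k), trivIset `I_n E &
      forall k, (k < n)%N -> E k `<=` A].

(* Finite families of pairwise disjoint measurable subsets of A, rather than
   partitions of A: adding the remainder of A to a family can only increase the
   sum, so the supremum is the same for measurable A. *)
Definition vvariation nu A : \bar R :=
  ereal_sup [set s | exists n (E : nat -> set T), disjoint_family A n E /\
                     s = (\sum_(k < n) enorm (vval nu (E k)))%:E].

Lemma vvariation_ub nu A n (E : nat -> set T) : disjoint_family A n E ->
  ((\sum_(k < n) enorm (vval nu (E k)))%:E <= vvariation nu A)%E.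
Proof. by move=> dE; apply: ereal_sup_ubound; exists n, E. Qed.

Lemma vvariation_ge0 nu A : (0 <= vvariation nu A)%E.
Proof.
have := @vvariation_ub nu A 0 (fun=> set0); rewrite big_ord0; apply.
by split => // i j [].
Qed.

Lemma enorm_vval_le_tv nu A B : measurable B -> B `<=` A ->
  ((enorm (vval nu B))%:E <= vvariation nu A)%E.
Proof.
move=> mB BA; have := @vvariation_ub nu A 1 (fun=> B); rewrite big_ord1.
apply; split => // i j /=.
by rewrite !ltnS !leqn0 => /eqP-> /eqP->.
Qed.

Lemma enorm_vval0 nu : enorm (vval nu set0) = 0.
Proof.
by rewrite /enorm big1 ?sqrtr0// => i _; rewrite mxE charge0 expr0n.
Qed.

Lemma vvariation0 nu : vvariation nu set0 = 0%E.
Proof.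
apply/eqP; rewrite eq_le vvariation_ge0 andbT.
apply/ereal_supP => _ [n [E [[_ _ E0] ->]]].
rewrite big1// => k _; have := E0 k (ltn_ord k).
by rewrite subset0 => ->; rewrite enorm_vval0.
Qed.

Lemma vvariation_fin_num nu A : vvariation nu A \is a fin_num.
Proof.
rewrite ge0_fin_numE ?vvariation_ge0//.
have /choice[P /choice[N nuPN]] := fun i => Hahn_decomposition (nu i).
pose b := (\sum_i charge_variation (nuPN i) setT)%E.
apply: (@le_lt_trans _ _ b); last first.
  by apply: lte_sum_pinfty => i _; rewrite ltey_eq fin_num_measure.
apply/ereal_supP => _ [n [E [[mE tE _] ->]]].
rewrite -sumEFin.
apply: (@le_trans _ _
    (\sum_(k < n) \sum_i charge_variation (nuPN i) (E k))%E).
  apply: lee_sum => k _.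
  apply: (@le_trans _ _ (\sum_i `|vval nu (E k) i 0|)%:E).
    by rewrite lee_fin enorm_le_sum.
  rewrite -sumEFin; apply: lee_sum => i _; rewrite mxE -abse_EFin.
  by rewrite fineK ?fin_num_measure// abse_charge_variation.
rewrite exchange_big/=; apply: lee_sum => i _.
rewrite -measure_semi_additive_ord_I//; last exact: bigsetU_measurable.
by rewrite le_measure// inE//; exact: bigsetU_measurable.
Qed.

Lemma vvariationU nu A B : A `&` B = set0 ->
  (vvariation nu A + vvariation nu B
     <= vvariation nu (A `|` B))%E.
Proof.
move=> AB0.
suff key : forall n (E : nat -> set T) m (F : nat -> set T),
    disjoint_family A n E -> disjoint_family B m F ->
    ((\sum_(k < n) enorm (vval nu (E k)))%:E +
     (\sum_(k < m) enorm (vval nu (F k)))%:E <= vvariation nu (A `|` B))%E.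
  rewrite -leeBrDr ?vvariation_fin_num//.
  apply/ereal_supP => _ [n [E [dE ->]]].
  rewrite leeBrDr ?vvariation_fin_num// addeC -leeBrDr//.
  apply/ereal_supP => _ [m [F [dF ->]]].
  by rewrite leeBrDr// addeC; exact: key.
move=> n E m F [mE tE EA] [mF tF FB].
pose G k := if (k < n)%N then E k else F (k - n)%N.
have -> : ((\sum_(k < n) enorm (vval nu (E k)))%:E +
     (\sum_(k < m) enorm (vval nu (F k)))%:E =
     (\sum_(k < n + m) enorm (vval nu (G k)))%:E)%E.
  rewrite -EFinD big_split_ord/=; congr (_ + _)%:E.
    by apply: eq_bigr => k _; rewrite /G ltn_ord.
  by apply: eq_bigr => k _; rewrite /G ltnNge leq_addr/= addKn.
apply: vvariation_ub; split.
- by move=> k; rewrite /G; case: ifP.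
- move=> i j /= ilt jlt; rewrite /G.
  case: ltnP => ni; case: ltnP => nj [x [xi xj]].
  + by apply: tE => //; exists x.
  + have : (A `&` B) x.
      by split; [exact: EA xi|apply: FB xj; rewrite ltn_subLR].
    by rewrite AB0.
  + have : (A `&` B) x.
      by split; [exact: EA xj|apply: FB xi; rewrite ltn_subLR].
    by rewrite AB0.
  + have : (i - n = j - n)%N.
      by apply: tF => /=; rewrite ?ltn_subLR//; exists x.
    by move/(congr1 (addn n)); rewrite !subnKC.
- move=> k klt; rewrite /G; case: ltnP => nk x Gx; [left; exact: EA Gx|right].
  by apply: FB Gx; rewrite ltn_subLR.
Qed.

Lemma le_vvariation nu A B : A `<=` B ->
  (vvariation nu A <= vvariation nu B)%E.
Proof.
move=> AB; apply/ereal_supP => _ [n [E [[mE tE EA] ->]]].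
by apply: vvariation_ub; split => // k /EA /subset_trans; exact.
Qed.

Lemma enorm_vval_sigma_subadditive nu (F : nat -> set T) :
  (forall k, measurable (F k)) -> trivIset setT F ->
  ((enorm (vval nu (\bigcup_k F k)))%:E
     <= \sum_(0 <= k <oo) (enorm (vval nu (F k)))%:E)%E.
Proof.
move=> mF tF; set v := vval nu _.
have [v0|v0] := eqVneq (enorm v) 0.
  by rewrite v0; apply: nneseries_ge0 => k _ _; rewrite lee_fin enorm_ge0.
pose u : 'cV[R]_l := \col_i (v i 0 / enorm v).
have u1 : \sum_i u i 0 ^+ 2 = 1.
  under eq_bigr do rewrite mxE exprMn.
  by rewrite -mulr_suml -enorm_sq -exprMn mulfV// expr1n.
pose a n := \sum_i u i 0 * \sum_(0 <= k < n) vval nu (F k) i 0.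
have aS n : ((a n)%:E <= \sum_(0 <= k <oo) (enorm (vval nu (F k)))%:E)%E.
  apply: (@le_trans _ _ (\sum_(0 <= k < n) (enorm (vval nu (F k)))%:E)%E).
    rewrite sumEFin lee_fin /a.
    under eq_bigr do rewrite mulr_sumr.
    by rewrite exchange_big/=; apply: ler_sum => k _; exact: dot_le_enorm.
  by apply: nneseries_lim_ge => k _ _; rewrite lee_fin enorm_ge0.
have cva : a n @[n --> \oo] --> enorm v.
  have -> : enorm v = \sum_i u i 0 * v i 0.
    under eq_bigr do rewrite mxE mulrAC -expr2.
    by rewrite -mulr_suml -enorm_sq expr2 mulfK.
  apply: cvg_big => [|i _]; first exact: add_continuous.
   apply: cvgMl_tmp.
  rewrite mxE.
  have mU : measurable (\bigcup_k F k) by exact: bigcup_measurable.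
  have nuU : nu i (\bigcup_k F k) \is a fin_num by rewrite fin_num_measure.
  have := @charge_semi_sigma_additive _ _ _ (nu i) F mF tF mU.
  rewrite -(fineK nuU) => /fine_cvg.
  apply: cvg_trans; apply: near_eq_cvg; apply: nearW => n /=.
  rewrite -sum_fine; last by move=> k _; rewrite fin_num_measure.
  by apply: eq_bigr => k _; rewrite mxE.
have cvaE : (a n)%:E @[n --> \oo] --> (enorm v)%:E.
  by apply: cvg_EFin => //; exact: nearW.
rewrite -(cvg_lim _ cvaE)//; apply: lime_le; last exact: nearW.
by apply/cvg_ex; exists (enorm v)%:E.
Qed.

Lemma vvariation_sigma_additive nu :
  semi_sigma_additive (vvariation nu).
Proof.
move=> F mF tF mUF.
have cv : cvgn (fun n => \sum_(0 <= i < n) vvariation nu (F i))%E.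
  by apply: is_cvg_nneseries => k _ _; exact: vvariation_ge0.
suff <- : (\sum_(0 <= k <oo) vvariation nu (F k))%E =
    vvariation nu (\bigcup_n F n) by [].
apply/eqP; rewrite eq_le; apply/andP; split.
  apply: lime_le => //; apply: nearW => n.
  apply: (@le_trans _ _ (vvariation nu (\big[setU/set0]_(0 <= i < n) F i))).
    elim: n => [|n ih]; first by rewrite !big_geq// vvariation0.
    rewrite !big_nat_recr//=; apply: le_trans (vvariationU _ _).
      by rewrite leeD2r.
    rewrite big_mkord; apply: (@trivIset_bigsetUI _ predT F _ n n) => //.
    exact: sub_trivIset tF.
  apply: le_vvariation; rewrite big_mkord; exact: bigsetU_bigcup.
apply/ereal_supP => _ [n [E [[mE tE EF] ->]]].
rewrite -sumEFin.
apply: (@le_trans _ _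
  (\sum_(k < n) \sum_(0 <= i <oo) (enorm (vval nu (E k `&` F i)))%:E)%E).
  apply: lee_sum => k _.
  rewrite -{1}(setIidl (EF k (ltn_ord k))) setI_bigcupr.
  apply: enorm_vval_sigma_subadditive.
    by move=> i; exact: measurableI.
  exact: trivIset_setIl.
rewrite -nneseries_sum; last by move=> *; rewrite lee_fin enorm_ge0.
apply: lee_nneseries => [i _ _|i _].
  by rewrite sume_ge0// => k _; rewrite lee_fin enorm_ge0.
rewrite sumEFin; apply: (@vvariation_ub nu (F i) n (fun k => E k `&` F i)).
split => [k||k _]; [exact: measurableI| |exact: subIsetr].
exact: trivIset_setIr.
Qed.

HB.instance Definition _ nu := isMeasure.Build _ _ _ (vvariation nu)
  (vvariation0 nu) (vvariation_ge0 nu)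
  (@vvariation_sigma_additive nu).

HB.instance Definition _ nu := @Measure_isFinite.Build _ _ _
  (vvariation nu) (fun A _ => vvariation_fin_num nu A).

End vector_measure.

Section decomposition_and_density.
Context d (T : measurableType d) (R : realType) (l : nat).
Implicit Types nu : vmeasure T R l.

Definition vdominates nu (mu : {measure set T -> \bar R}) :=
  forall i, nu i `<< mu.

Definition vsingular nu (mu : {measure set T -> \bar R}) :=
  exists N, [/\ measurable N, mu N = 0%E &
                forall i, (nu i).-null_set (~` N)].

Definition Lebesgue_decomposition (mu : {measure set T -> \bar R})
    (nu nu_abs nu_s : vmeasure T R l) :=
  [/\ forall A, measurable A -> forall i, nu i A = (nu_abs i A + nu_s i A)%E,
      vdominates nu_abs mu & vsingular nu_s mu].

Lemma vdominates_vvariation nu : vdominates nu (vvariation nu).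
Proof.
move=> i; apply/null_content_dominatesP => A mA tvA0.
have : ((enorm (vval nu A))%:E <= 0)%E by rewrite -tvA0 enorm_vval_le_tv.
rewrite lee_fin => nA0; apply/eqP.
rewrite -(@fineK _ (nu i A)) ?fin_num_measure// eqe.
have : \sum_j vval nu A j 0 ^+ 2 == 0.
  by rewrite -enorm_sq sqrf_eq0 eq_le nA0 enorm_ge0.
rewrite psumr_eq0 => [/allP/(_ i)|j _]; last exact: sqr_ge0.
by rewrite mem_index_enum mxE/= sqrf_eq0 => /(_ isT).
Qed.

(* The density of nu with respect to its own total variation; the components
   are finite by vdominates_vvariation. *)
Definition polar_density nu (x : T) : 'cV[R]_l :=
  \col_i fine (('d (nu i) '/d (vvariation nu)) x).

End decomposition_and_density.

(* The vertices of the q-regular rooted tree with enumerated sons are the words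
   over 'I_q: the root is [::] and the sons of v are the words rcons v i. *)
Section tree.
Context (q : nat).

Definition is_tree_path (x : nat -> seq 'I_q) :=
  x 0 = [::] /\ forall n, exists i, x n.+1 = rcons (x n) i.

(* The unused bound on q is only there to make the type of paths pointed. *)
Definition tree_path (hq : (3 <= q)%N) := {x : nat -> seq 'I_q | is_tree_path x}.

Context (hq : (3 <= q)%N).

Definition leftmost_path (n : nat) : seq 'I_q :=
  nseq n (Ordinal (ltnW (ltnW hq))).

Lemma leftmost_pathP : is_tree_path leftmost_path.
Proof.
split=> // n; exists (Ordinal (ltnW (ltnW hq))).
by rewrite /leftmost_path -addn1 nseqD cats1.
Qed.

HB.instance Definition _ := gen_eqMixin (tree_path hq).
HB.instance Definition _ := gen_choiceMixin (tree_path hq).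
HB.instance Definition _ :=
  isPointed.Build (tree_path hq) (exist _ leftmost_path leftmost_pathP).

Definition atom (v : seq 'I_q) : set (tree_path hq) :=
  [set x | sval x (size v) = v].

Definition atoms n : set (set (tree_path hq)) :=
  [set atom v | v in [set v | size v = n]].

(* The members of the algebra generated by [atoms n] are the finite unions of
   atoms of generation n, so the atoms generate the same sigma-algebra. *)
Definition path_space := g_sigma_algebraType (\bigcup_n atoms n).

End tree.
Arguments atom {q} hq v.

Section martingale.
Context (R : realType) (q : nat) (hq : (3 <= q)%N) (l : nat).
Implicit Types (nu : vmeasure (path_space hq) R l) (W : {vspace 'M[R]_(l, q)}).

Definition uniform_measure (mu : set (path_space hq) -> \bar R) :=
  forall v : seq 'I_q, mu (atom hq v) = (q%:R ^- size v)%:E.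

(* The value on the atom of v of the martingale nu_n, where n = size v. *)
Definition mart nu (v : seq 'I_q) : 'cV[R]_l :=
  q%:R ^+ size v *: vval nu (atom hq v).

Definition diff_mx nu (v : seq 'I_q) : 'M[R]_(l, q) :=
  \matrix_(k, i) (mart nu (rcons v i) - mart nu v) k 0.

Definition Diff nu : set 'M[R]_(l, q) := [set diff_mx nu v | v in setT].

Definition frakW W : set (vmeasure (path_space hq) R l) :=
  [set nu | Diff nu `<=` [set D | D \in W]].

Definition wave_cone W : set 'cV[R]_l :=
  [set v | exists w : 'cV[R]_q,
      [/\ \sum_j w j 0 = 0, w != 0 & v *m w^T \in W]].

End martingale.

(* Main.v *)
(* Suppose d nu / d|nu| is close to some v outside the wave cone on a mu-null
   set B with |nu| B > 0, and choose an atom omega almost filled by B with respect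
   to |nu|. Write sigma = nu - v |nu|, which is small relative to |nu| on omega.
   The differences of nu lie in W, and w |-> v (x) w is injective modulo W on the
   vectors of zero sum, so the differences of the martingale |nu|_n are dominated
   by those of sigma_n. A weak-type (1,1) estimate then keeps |nu|_n close to its
   value on omega outside a set of small mu-measure; since |nu|_n is nonnegative
   with constant mean, that set also has small |nu|-measure. Hence |nu| cannot
   concentrate on the mu-small neighbourhoods of B, a contradiction. Countably
   many rational balls cover the complement of the wave cone. *)
Require Import Defs.
From mathcomp Require Import all_boot all_order all_algebra.
From mathcomp Require Import ring lra.
From mathcomp Require Import all_classical all_reals all_analysis.
From mathcomp Require Import measurable_realfun.

Set Implicit Arguments.
Unset Strict Implicit.
Unset Printing Implicit Defensive.

Import Order.TTheory GRing.Theory Num.Theory.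
Import numFieldNormedType.Exports.

Local Open Scope classical_set_scope.
Local Open Scope ring_scope.
Local Open Scope charge_scope.

(** * Martingales on the words of the tree and a weak-type estimate *)

Section tree_martingales.
Context (R : realType) (q : nat) (q0 : (0 < q)%N).
Implicit Types (f g h : seq 'I_q -> R) (v : seq 'I_q).

Definition tree_martingale f :=
  forall v, \sum_i f (rcons v i) = q%:R * f v.

(** The conditional expectation at [v], under the uniform measure, of [f] taken [m] generations
    below [v]. *)
Fixpoint avg m f v : R :=
  if m is m'.+1 then q%:R^-1 * \sum_i avg m' f (rcons v i) else f v.

Let qR0 : 0 < q%:R :> R. Proof. by rewrite ltr0n. Qed.

Lemma le_avg m f g v : (forall u, f u <= g u) -> avg m f v <= avg m g v.
Proof.
move=> fg; elim: m v => [|m ih] v //=.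
by rewrite ler_wpM2l ?invr_ge0 ?(ltW qR0)//; apply: ler_sum => i _; exact: ih.
Qed.

Lemma avgD m f g v : avg m (fun u => f u + g u) v = avg m f v + avg m g v.
Proof.
elim: m v => [|m ih] v //=.
by rewrite -mulrDr -big_split/=; under eq_bigr do rewrite ih.
Qed.

Lemma avgZ m c f v : avg m (fun u => c * f u) v = c * avg m f v.
Proof.
elim: m v => [|m ih] v //=.
by under eq_bigr do rewrite ih; rewrite -mulr_sumr mulrCA.
Qed.

Lemma avg_tree_martingale m f v : tree_martingale f -> avg m f v = f v.
Proof.
move=> mf; elim: m v => [|m ih] v //=.
by under eq_bigr do rewrite ih; rewrite mf mulKf// gt_eqF.
Qed.

Lemma avg_cst m c v : avg m (fun=> c) v = c.
Proof.
apply: (@avg_tree_martingale m (fun=> c)) => u.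
by rewrite sumr_const card_ord mulr_natl.
Qed.

Lemma tree_martingaleD (c1 c2 : R) f g : tree_martingale f ->
  tree_martingale g -> tree_martingale (fun u => c1 * f u + c2 * g u).
Proof.
by move=> mf mg v; rewrite big_split/= -!mulr_sumr mf mg; ring.
Qed.

Lemma tree_martingale_le_son h v i : tree_martingale h ->
  (forall u, 0 <= h u) -> h (rcons v i) <= q%:R * h v.
Proof.
by move=> mh h0; rewrite -mh (bigD1 i)//= lerDl sumr_ge0.
Qed.

(** Orthogonality of increments: those over the sons of [v] sum to zero, so the cross term
    vanishes. *)
Lemma sum_sqr_tree_martingale f v c : tree_martingale f ->
  \sum_i (f (rcons v i) - c) ^+ 2 =
  q%:R * (f v - c) ^+ 2 + \sum_i (f (rcons v i) - f v) ^+ 2.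
Proof.
move=> mf.
have E x : (x - c) ^+ 2 = (x - f v) ^+ 2 + (f v - c) *+ 2 * x
   + (c ^+ 2 - f v ^+ 2) by ring.
under eq_bigr do rewrite E.
rewrite !big_split/= -mulr_sumr mf !sumr_const !card_ord.
by rewrite -[_ *+ q]mulr_natl; ring.
Qed.

(* A Bellman function argument: the right-hand side is a supermartingale as long
   as [h <= lam], and it exceeds [lam ^+ 2] as soon as [lam < h <= q * lam]. *)
Lemma weak_type_avg (l : nat) g h (s : 'I_l -> seq 'I_q -> R) (C lam a : R) m v :
  tree_martingale g -> tree_martingale h -> (forall k, tree_martingale (s k)) ->
  (forall k u, `|s k u| <= h u) -> 1 <= C -> 0 < lam ->
  (forall u, \sum_i (g (rcons u i) - g u) ^+ 2 <=
     C * \sum_k \sum_i (s k (rcons u i) - s k u) ^+ 2) ->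
  (forall u, 0 <= h u) ->
  h v <= q%:R * lam ->
  lam ^+ 2 * avg m (fun u => (lam < `|g u - a|)%R%:R) v <=
  (g v - a) ^+ 2 + C * ((l * q).+1%:R * lam * h v - \sum_k s k v ^+ 2).
Proof.
move=> mg mh ms sh C1 lam0 gs h0; have C0 : 0 <= C by rewrite (le_trans _ C1).
(* While [h u <= q * lam], the squares of the [s k u] sum to at most [l * q * lam * h u]; the extra
   unit in [(l * q).+1] leaves a surplus [C * lam * h u]. *)
have s2 u : h u <= q%:R * lam ->
    C * lam * h u <= C * ((l * q).+1%:R * lam * h u - \sum_k s k u ^+ 2).
  move=> hu; rewrite -mulrA ler_wpM2l//.
  have : \sum_k s k u ^+ 2 <= \sum_(k < l) q%:R * lam * h u.
    apply: ler_sum => k _; rewrite -real_normK ?num_real// expr2.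
    by rewrite ler_pM// (le_trans (sh k u)).
  rewrite sumr_const card_ord -[_ *+ l]mulr_natl => sl.
  rewrite -addn1 natrD natrM; lra.
set B := fun u => (g u - a) ^+ 2 +
  C * ((l * q).+1%:R * lam * h u - \sum_k s k u ^+ 2).
rewrite -/(B v); elim: m v => [|m ih] v hv.
  have B0 : (g v - a) ^+ 2 <= B v.
    by rewrite lerDl (le_trans _ (s2 _ hv))// !mulr_ge0// ltW.
  rewrite /=; case: ltP => [ga|_].
    rewrite mulr1 (le_trans _ B0)// -[leRHS]real_normK ?num_real//.
    by rewrite ler_pXn2r// ?nnegrE ltW.
  by rewrite mulr0 (le_trans _ B0)// sqr_ge0.
(* Once [h] exceeds [lam], the average is at most 1 and the surplus [C * lam * h v] alone beats
   [lam ^+ 2]. *)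
have [hl|hl] := ltP lam (h v).
  have avg1 : avg m.+1 (fun u => (lam < `|g u - a|)%R%:R) v <= 1.
    by rewrite -[leRHS](avg_cst m.+1 1 v); apply: le_avg => u; case: ltP.
  apply: (@le_trans _ _ (lam ^+ 2)); first by rewrite ler_piMr// sqr_ge0.
  have : lam ^+ 2 <= C * (lam * h v).
    rewrite -[leLHS]mul1r ler_pM ?sqr_ge0// expr2.
    by rewrite ler_wpM2l// ltW.
  have := s2 _ hv; have := sqr_ge0 (g v - a); rewrite /B; lra.
(* Otherwise no son exceeds [q * lam], and the induction hypothesis applies to each of them. *)
have hson i : h (rcons v i) <= q%:R * lam.
  by rewrite (le_trans (tree_martingale_le_son v i mh h0))// ler_wpM2l// ltW.
rewrite /= mulrCA mulr_sumr.
have -> : B v = q%:R^-1 * (q%:R * B v) by rewrite mulKf// gt_eqF.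
rewrite ler_wpM2l ?invr_ge0 ?(ltW qR0)//.
apply: (@le_trans _ _ (\sum_i B (rcons v i))).
  by apply: ler_sum => i _; apply: ih.
(* By orthogonality the sum over the sons is [q * B v] plus the squared increments of [g] minus [C]
   times those of the [s k]; [gs] makes this correction nonpositive. *)
rewrite /B big_split/= (sum_sqr_tree_martingale _ _ mg) -mulr_sumr sumrB.
rewrite -mulr_sumr mh exchange_big/=.
have E k : \sum_i s k (rcons v i) ^+ 2 =
    q%:R * s k v ^+ 2 + \sum_i (s k (rcons v i) - s k v) ^+ 2.
  have := sum_sqr_tree_martingale v 0 (ms k); rewrite subr0 => <-.
  by apply: eq_bigr => i _; rewrite subr0.
rewrite (eq_bigr _ (fun k _ => E k)).
rewrite big_split/= -mulr_sumr.
have := gs v; lra.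
Qed.

(** The bound holds pointwise once the first [lam] is replaced by [g + (lam - a)], whose mean is
    [lam] because [g] has mean [a]. Conservation of mass thus limits what [g] carries on the
    exceptional event. *)
Lemma avg_pos_part_le m g (U : pred (seq 'I_q)) (a lam : R) v :
  tree_martingale g -> (forall u, 0 <= g u) -> 0 <= lam <= a -> g v = a ->
  avg m (fun u => g u * (U u)%:R) v <=
  lam + (a - lam) * avg m (fun u => (lam < `|g u - a|)%R%:R) v
      + (a + lam) * avg m (fun u => (U u)%:R) v.
Proof.
move=> mg g0 /andP[lam0 la] gv.
have E : avg m (fun u => g u + (lam - a)) v = lam.
  by rewrite avgD avg_cst avg_tree_martingale// gv addrC subrK.
rewrite -[X in _ <= X + _ + _]E -!avgZ -!avgD; apply: le_avg => u.
have := g0 u; case: ltP => [_|]; case: (U u) => /=; rewrite ?ler_norml; lra.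
Qed.

(** At level [lam = g v / 8], the factor 64 makes the weak-type probability at most 1/8, and
    [avg_pos_part_le] then leaves [1/8 + 7/64 < 1/4] of [g v] besides the term in [U]. *)
Lemma avg_le_of_small_transform (l : nat) g h (s : 'I_l -> seq 'I_q -> R)
    (U : pred (seq 'I_q)) (C : R) m v :
  tree_martingale g -> tree_martingale h -> (forall k, tree_martingale (s k)) ->
  (forall k u, `|s k u| <= h u) -> 1 <= C ->
  (forall u, \sum_i (g (rcons u i) - g u) ^+ 2 <=
     C * \sum_k \sum_i (s k (rcons u i) - s k u) ^+ 2) ->
  (forall u, 0 <= h u) -> (forall u, 0 <= g u) -> 0 < g v ->
  64 * (C * (l * q).+1%:R) * h v <= g v ->
  avg m (fun u => g u * (U u)%:R) v <=
  g v / 4 + 9 / 8 * g v * avg m (fun u => (U u)%:R) v.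
Proof.
move=> mg mh ms sh C1 gs h0 g0 a0 hv; set a := g v in a0 hv *.
pose lam := a / 8; have lam0 : 0 < lam by rewrite divr_gt0.
set K : R := (l * q).+1%:R in hv.
have K1 : 1 <= K by rewrite ler1n.
have hv' : h v <= q%:R * lam.
  have CK1 : 1 <= C * K by rewrite mulr_ege1.
  have : h v <= C * K * h v by rewrite ler_peMl.
  have : lam <= q%:R * lam by rewrite ler_peMl ?ler1n// ltW.
  rewrite /lam; have := h0 v; lra.
have := @weak_type_avg l g h s C lam a m v mg mh ms sh C1 lam0 gs h0 hv'.
rewrite -/a subrr expr0n/= add0r -/K.
set P := avg m _ v => wk.
have S0 : 0 <= C * \sum_k s k v ^+ 2.
  by rewrite mulr_ge0 ?(le_trans _ C1)// sumr_ge0// => k _; rewrite sqr_ge0.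
have P8 : P <= 1 / 8.
  rewrite -(ler_pM2l (exprn_gt0 2 lam0)) (le_trans wk)//.
  have : lam * (64 * (C * K) * h v) <= lam * a by rewrite ler_wpM2l// ltW.
  have : a = 8 * lam by rewrite /lam; lra.
  move=> ->; rewrite mulrBr; lra.
apply: le_trans (@avg_pos_part_le m g U a lam v mg g0 _ erefl) _.
  by rewrite ltW//= /lam; lra.
rewrite -/P; have : (a - lam) * P <= (a - lam) * (1 / 8).
  by rewrite ler_wpM2l// /lam; lra.
by rewrite /lam; lra.
Qed.

End tree_martingales.

(** * Atoms, cylinders, and approximation of measurable sets by cylinders *)

Section path_space_theory.
Context (R : realType) (q : nat) (hq : (3 <= q)%N).
Local Notation T := (path_space hq).
Implicit Types (v : seq 'I_q) (p : pred (seq 'I_q)) (x : T) (A B : set T).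
Implicit Types rho : {charge set T -> \bar R}.

(** For fixed [m] these are the members of the algebra generated by the atoms of generation [m]. *)
Definition cylinder m p : set T := [set x | p (sval x m)].

Lemma cylinder_pred0 m : cylinder m pred0 = set0.
Proof. by apply/seteqP; split. Qed.

Lemma size_tree_path x n : size (sval x n) = n.
Proof.
case: x => x [x0 xS] /=; elim: n => [|n ih]; first by rewrite x0.
by have [i ->] := xS n; rewrite size_rcons ih.
Qed.

Lemma take_tree_path x m n : (n <= m)%N -> take n (sval x m) = sval x n.
Proof.
move=> /subnK <-; elim: (m - n)%N => [|k ih].
  by rewrite take_oversize// size_tree_path.
rewrite addSn -ih; case: x {ih} => x xP /=; have [i ->] := xP.2 (k + n)%N.
rewrite -cats1 takel_cat// (size_tree_path (exist _ x xP)) leq_addl//.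
Qed.

Lemma measurable_atom v : measurable (atom hq v : set T).
Proof. by apply: sub_sigma_algebra; exists (size v) => //; exists v. Qed.

Lemma atom_sons v : atom hq v = \bigcup_i atom hq (rcons v i) :> set T.
Proof.
apply/seteqP; split => [x|x [i _]]; rewrite /atom/= => xv.
  have [i xi] := (svalP x).2 (size v).
  by exists i => //=; rewrite size_rcons xi xv.
move: xv; rewrite size_rcons -(take_tree_path x (leqnSn (size v))) => ->.
by rewrite -cats1 take_size_cat.
Qed.

Lemma atom_sons_disjoint v i j x :
  atom hq (rcons v i) x -> atom hq (rcons v j) x -> i = j.
Proof. by rewrite /atom/= !size_rcons => -> /rcons_inj[]. Qed.

Lemma charge_atom_sons rho B v : measurable B ->
  \sum_i fine (rho (atom hq (rcons v i) `&` B)) = fine (rho (atom hq v `&` B)).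
Proof.
move=> mB.
pose F k : set T := if insub k is Some i then atom hq (rcons v i) `&` B else set0.
have FE (i : 'I_q) : F i = atom hq (rcons v i) `&` B by rewrite /F valK.
have mF k : measurable (F k).
  by rewrite /F; case: insub => [i|//]; apply: measurableI => //; apply: measurable_atom.
have FU : atom hq v `&` B = \big[setU/set0]_(i < q) F i.
  rewrite -bigcup_mkord atom_sons setI_bigcupl.
  apply/seteqP; split => [x [i _ xi]|x [k /= kq]].
    by exists (val i) => //=; rewrite ?FE.
  by rewrite (FE (Ordinal kq)) => ?; exists (Ordinal kq).
have := @charge_semi_additive _ _ _ rho F q mF.
rewrite FU => ->; last exact: bigsetU_measurable.
  rewrite -sum_fine; last by move=> i _; rewrite fin_num_measure.
  by apply: eq_bigr => i _; rewrite FE.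
move=> i j _ _; rewrite /F.
case: insubP => [i' _ <-|_]; last by rewrite set0I => -[].
case: insubP => [j' _ <-|_]; last by rewrite setI0 => -[].
by move=> [x [[xi _] [xj _]]]; rewrite (atom_sons_disjoint xi xj).
Qed.

Lemma measurable_atom_cylinder v m p :
  measurable (atom hq v `&` cylinder (size v + m) p : set T).
Proof.
elim: m v => [|m ih] v.
  rewrite addn0; have [pv|pv] := boolP (p v).
    rewrite (_ : _ `&` _ = atom hq v); first exact: measurable_atom.
    by apply/seteqP; split => [x []//|x xv]; split=> //; rewrite /cylinder/= xv.
  rewrite (_ : _ `&` _ = set0)//; apply/seteqP; split => // x [].
  by rewrite /cylinder /atom/= => ->; exact/negP.
rewrite atom_sons setI_bigcupl; apply: fin_bigcup_measurable => // i _.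
by have := ih (rcons v i); rewrite size_rcons addSnnS.
Qed.

Lemma measurable_cylinder m p : measurable (cylinder m p).
Proof.
have := measurable_atom_cylinder [::] m p; congr measurable.
by apply/seteqP; split => [x []//|x xp]; split => //; exact: (svalP x).1.
Qed.

(** The mean density of [r] on the atom of [v] relative to the uniform measure. *)
Definition adens (r : set T -> R) v := q%:R ^+ size v * r (atom hq v).

Lemma adens_tree_martingale rho B : measurable B ->
  tree_martingale (adens (fun A => fine (rho (A `&` B)))).
Proof.
move=> mB v; rewrite /adens; under eq_bigr do rewrite size_rcons.
by rewrite -mulr_sumr charge_atom_sons// exprS mulrA.
Qed.

(** Turns averages over words back into masses: the factor [q] gained at each generation cancels the
    normalization in [avg]. *)
Lemma avg_adens rho B m p v : measurable B ->
  avg m (fun u => adens (fun A => fine (rho (A `&` B))) u * (p u)%:R) v =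
  q%:R ^+ size v * fine (rho (atom hq v `&` (cylinder (size v + m) p `&` B))).
Proof.
move=> mB; elim: m v => [|m ih] v.
  rewrite /= addn0 /adens -mulrA; congr (_ * _).
  have [pv|pv] := boolP (p v).
    rewrite mulr1; congr (fine (rho _)).
    apply/seteqP; split => [x [xv Bx]|x [xv []]//].
    by split=> //; rewrite /cylinder/= xv.
  rewrite mulr0 (_ : _ `&` _ = set0) ?charge0//.
  apply/seteqP; split => // x [+ []].
  by rewrite /cylinder /atom/= => ->; move/negP: pv.
rewrite /= -charge_atom_sons; last first.
  by apply: measurableI => //; exact: measurable_cylinder.
under eq_bigr do rewrite ih size_rcons addSnnS.
rewrite -mulr_sumr exprS -mulrA mulKf//.
by rewrite pnatr_eq0 -lt0n (leq_trans _ hq).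
Qed.

(** All generations from [m0] on are required, so that two approximations can share a generation and
    one can be taken below a prescribed atom. *)
Definition cylinder_approximable (rho : {measure set T -> \bar R}) A :=
  forall e : R, 0 < e -> exists m0, forall m, (m0 <= m)%N -> exists p,
    (rho (A `\` cylinder m p) < e%:E)%E /\ (rho (cylinder m p `\` A) < e%:E)%E.

(** The approximable measurable sets contain the atoms and form a sigma-algebra; measurability is
    carried along because the measure estimates use it. *)
Lemma cylinder_approx (rho : {measure set T -> \bar R}) A :
  (rho setT < +oo)%E -> measurable A -> cylinder_approximable rho A.
Proof.
move=> rhoT mA; suff [] : measurable A /\ cylinder_approximable rho A by [].
move: A mA; apply: smallest_sub; last first.
  move=> _ [n _ [v _ <-]]; split; first exact: measurable_atom.
  move=> e e0; exists (size v) => m vm; exists (fun u => take (size v) u == v).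
  suff -> : cylinder m (fun u => take (size v) u == v) = atom hq v.
    by rewrite setDv measure0 lte_fin.
  by apply/seteqP; split => x; rewrite /cylinder /atom/= take_tree_path// => ?;
    exact/eqP.
split.
- split=> // e e0; exists 0 => m _; exists pred0.
  by rewrite cylinder_pred0 set0D measure0 lte_fin.
- move=> A [mA Aa]; rewrite setTD; split; first exact: measurableC.
  move=> e e0; have [m0 Am] := Aa e e0; exists m0 => m /Am[p [p1 p2]].
  exists (predC p).
  have -> : cylinder m (predC p) = ~` cylinder m p.
    by apply/seteqP; split => x /= /negP.
  by rewrite !setDE !setCK ![~` _ `&` _]setIC -!setDE.
move=> F FP.
have mF k : measurable (F k : set T) by have [] := FP k.
split; first exact: bigcup_measurable.
move=> e e0.
have fin n : cylinder_approximable rho (\big[setU/set0]_(k < n) F k : set T).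
  elim: n => [|n ih] d d0.
    rewrite big_ord0; exists 0 => m _; exists pred0.
    by rewrite cylinder_pred0 set0D measure0 lte_fin.
  have d20 : 0 < d / 2 by rewrite divr_gt0.
  have [m1 H1] := ih _ d20; have [m2 H2] := (FP n).2 _ d20.
  exists (maxn m1 m2) => m; rewrite geq_max => /andP[/H1[p1 [a1 b1]] /H2[p2 [a2 b2]]].
  exists (predU p1 p2); rewrite big_ord_recr/=.
  set G := \big[_/_]_(_ < _) _.
  have mG : measurable (G : set T) by exact: bigsetU_measurable.
  have dE : d%:E = ((d / 2)%:E + (d / 2)%:E)%E by rewrite -EFinD -splitr.
  have mc := measurable_cylinder.
  split; rewrite dE.
    apply: le_lt_trans (lteD a1 a2); apply: le_trans (measureU2 _ _ _).
    + apply: le_measure; rewrite ?inE; try by do ?[apply: measurableU|apply: measurableD].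
      move=> x [[xG|xF] /negP]; rewrite /cylinder/= negb_or => /andP[/negP ? /negP ?].
        by left; split.
      by right; split.
    + by apply: measurableD.
    + by apply: measurableD.
  apply: le_lt_trans (lteD b1 b2); apply: le_trans (measureU2 _ _ _).
  + apply: le_measure; rewrite ?inE; try by do ?[apply: measurableU|apply: measurableD].
    move=> x [/orP[xp|xp] /not_orP[xG xF]].
      by left; split.
    by right; split.
  + by apply: measurableD.
  + by apply: measurableD.
have e20 : 0 < e / 2 by rewrite divr_gt0.
(* The tails [G n] decrease to the empty set, so a finite union replaces the countable one up to
   [e / 2]. *)
pose G n : set T := (\bigcup_k F k) `\` \big[setU/set0]_(k < n) F k.
have mG n : measurable (G n).
  by apply: measurableD; [exact: bigcup_measurable|exact: bigsetU_measurable].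
have cG : (rho \o G) n @[n --> \oo] --> 0%E.
  have G0 : \bigcap_n G n = set0.
    apply/seteqP; split => // x xG; have [[k _ xF] _] := xG 0 I.
    have [_] := xG k.+1 I; apply; rewrite big_ord_recr; by right.
  rewrite -(measure0 rho) -G0; apply: nonincreasing_cvg_mu => //.
  - by apply: le_lt_trans rhoT; apply: le_measure; rewrite ?inE.
  - by rewrite G0.
  - move=> m n mn; apply/subsetPset => x [xF nx]; split => // xm; apply: nx.
    move: xm; rewrite -!bigcup_mkord => -[k /= km xk].
    by exists k => //=; exact: leq_trans mn.
have [n Gn] : exists n, (rho (G n) < (e / 2)%:E)%E.
  have /fine_cvgP[Gfin /cvgr_lt/(_ _ e20) Glt] := cG.
  have [n _ /(_ n (leqnn n))[G1 G2]] := filterI Gfin Glt.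
  by exists n; move: G1 G2 => /= /fineK <-; rewrite lte_fin.
have [m0 H] := fin n _ e20; exists m0 => m /H[p [p1 p2]]; exists p.
set Fn := \big[_/_]_(_ < _) _ in p1 p2.
have mFn : measurable (Fn : set T) by exact: bigsetU_measurable.
have mc := measurable_cylinder m p.
have eE : e%:E = ((e / 2)%:E + (e / 2)%:E)%E by rewrite -EFinD -splitr.
have mU : measurable (\bigcup_k F k : set T) by exact: bigcup_measurable.
split; last first.
  apply: (@le_lt_trans _ _ (rho (cylinder m p `\` Fn))).
    apply: le_measure; rewrite ?inE; [exact: measurableD|exact: measurableD|].
    by apply: setDS; apply: bigsetU_bigcup.
  by apply: (lt_le_trans p2); rewrite lee_fin ler_pdivrMr// ler_pMr// ler1n.
rewrite eE; apply: le_lt_trans (lteD Gn p1).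
apply: le_trans (measureU2 _ _ _); [|exact: mG|exact: measurableD].
apply: le_measure; rewrite ?inE; [exact: measurableD| |].
  by apply: measurableU; [exact: mG|exact: measurableD].
move=> x [xF xp]; have [xn|xn] := pselect (Fn x); last by left.
by right.
Qed.

End path_space_theory.

(** * Linear algebra for a vector outside the wave cone *)

Lemma sqr_sum_mul_le (R : realType) (I : finType) (x y : I -> R) :
  (\sum_i x i * y i) ^+ 2 <= (\sum_i `|y i|) ^+ 2 * \sum_i x i ^+ 2.
Proof.
have X0 : 0 <= \sum_i x i ^+ 2 by rewrite sumr_ge0// => i _; rewrite sqr_ge0.
set X := \sum_i x i ^+ 2 in X0 *.
rewrite -[X]sqr_sqrtr// -exprMn -[leLHS]real_normK ?num_real//.
rewrite ler_pXn2r// ?nnegrE ?mulr_ge0 ?sqrtr_ge0 ?sumr_ge0//.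
apply: (le_trans (ler_norm_sum _ _ _)); rewrite mulr_suml ler_sum// => i _.
(* Each [|x i|] is at most the Euclidean norm of [x]. *)
rewrite normrM mulrC ler_wpM2l// -sqrtr_sqr ler_wsqrtr// /X (bigD1 i)//= lerDl.
by rewrite sumr_ge0// => j _; rewrite sqr_ge0.
Qed.

Section wave_cone_complement.
Context (R : realType) (l q : nat) (W : {vspace 'M[R]_(l, q)}) (v : 'cV[R]_l).

Lemma not_wave_cone_neq0 : (2 <= q)%N -> ~ wave_cone W v -> v != 0.
Proof.
move=> q2 vW; apply/eqP => v0; apply: vW.
pose i0 := Ordinal (ltnW q2); pose i1 := Ordinal q2.
exists (delta_mx i0 0 - delta_mx i1 0); split.
- under eq_bigr do rewrite !mxE !andbT.
  have sum1 (i : 'I_q) : \sum_j (j == i)%:R = 1 :> R.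
    by rewrite (bigD1 i)//= eqxx big1 ?addr0// => j /negbTE ->.
  by rewrite sumrB !sum1 subrr.
- apply/eqP => /matrixP/(_ i0 0); rewrite !mxE !eqxx/= subr0 => /eqP.
  by rewrite oner_eq0.
- by rewrite v0 mul0mx mem0v.
Qed.

(* Projecting along [W] kills [D + v w^T] and recovers [w] from [v w^T]. *)
Lemma not_wave_cone_bound : (2 <= q)%N -> ~ wave_cone W v ->
  exists2 C : R, 1 <= C & forall (D : 'M[R]_(l, q)) (w : 'cV[R]_q),
    \sum_j w j 0 = 0 -> D + v *m w^T \in W ->
    \sum_j w j 0 ^+ 2 <= C * \sum_k \sum_j D k j ^+ 2.
Proof.
move=> q2 vW; have [k vk0] : exists k, v k 0 != 0.
  apply/not_existsP => v0; have /eqP := not_wave_cone_neq0 q2 vW; apply.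
  by apply/matrixP => k j; rewrite (ord1 j) mxE; apply/eqP/negPn/negP; exact: v0.
(* [R0] is the hyperplane of vectors of zero sum and [S] the space of all [v w^T] with [w] in it. As
   [v] avoids the wave cone, [S] meets [W] only in 0, which permits the projection [P] onto [S]
   along [W]. *)
pose R0 := lker (linfun (mulmx (const_mx 1 : 'rV[R]_q) : 'cV[R]_q -> 'M[R]_1)).
pose Phi : 'Hom('cV[R]_q, 'M[R]_(l, q)) := linfun (mulmx v \o trmx).
pose S := (Phi @: R0)%VS.
have R0P w : (w \in R0) = (\sum_j w j 0 == 0).
  rewrite memv_ker lfunE/=; apply/eqP/eqP => [/matrixP/(_ 0 0)|w0].
    rewrite !mxE => w0; rewrite -[RHS]w0.
    by apply: eq_bigr => j _; rewrite mxE mul1r.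
  apply/matrixP => i j; rewrite (ord1 i) (ord1 j) !mxE -[RHS]w0.
  by apply: eq_bigr => j' _; rewrite mxE mul1r.
have SW : (S :&: W = 0)%VS.
  apply/eqP; rewrite -subv0; apply/subvP => u; rewrite memv_cap => /andP[].
  move=> /memv_imgP[w]; rewrite R0P => /eqP w0 ->; rewrite lfunE/= => uW.
  have [->|wn0] := eqVneq w 0; first by rewrite trmx0 mulmx0 mem0v.
  by exfalso; apply: vW; exists w.
pose P := daddv_pi S W.
have PW u : u \in W -> P u = 0.
  move=> uW; have WS : (W :&: S = 0)%VS by rewrite capvC.
  have := daddv_pi_add SW (subvP (addvSr S W) u uW).
  by rewrite (daddv_pi_id WS)// => /eqP; rewrite -subr_eq0 addrK => /eqP.
pose y j (ab : 'I_l * 'I_q) := P (delta_mx ab.1 ab.2) k j.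
have PE D j : P D k j = \sum_ab D ab.1 ab.2 * y j ab.
  rewrite {1}(matrix_sum_delta D) pair_bigA/= linear_sum summxE.
  by apply: eq_bigr => ab _; rewrite linearZ mxE.
(* Squared l1 norms of the coefficients of the linear forms [P D k j], divided by the square of the
   nonzero entry [v k 0] through which [w] is read off. *)
exists (1 + \sum_j (\sum_ab `|y j ab|) ^+ 2 / v k 0 ^+ 2).
  by rewrite lerDl sumr_ge0// => j _; rewrite divr_ge0 ?sqr_ge0.
move=> D w w0 DW.
have D0 : 0 <= \sum_k \sum_j D k j ^+ 2.
  by rewrite sumr_ge0// => i _; rewrite sumr_ge0// => j _; rewrite sqr_ge0.
have Pw : P (v *m w^T) = v *m w^T.
  apply: daddv_pi_id => //; apply/memv_imgP; exists w; last by rewrite lfunE.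
  by rewrite R0P w0.
rewrite mulrDl mul1r ler_wpDl// mulr_suml ler_sum// => j _.
have : v k 0 * w j 0 = - (P D k j).
  have := congr1 (fun M : 'M[R]_(l, q) => M k j) (PW _ DW).
  rewrite raddfD/= Pw !mxE big_ord1 !mxE => /eqP.
  by rewrite addrC addr_eq0 => /eqP.
move=> /(canRL (mulKf vk0)) ->.
rewrite exprMn sqrrN exprVn mulrC [leRHS]mulrAC ler_pM2r ?invr_gt0 ?exprn_even_gt0//.
by rewrite PE pair_bigA/=; exact: sqr_sum_mul_le.
Qed.

End wave_cone_complement.

(** * The density of a vector measure with respect to its variation *)

Section densities.
Context d (T : measurableType d) (R : realType) (l : nat).
Implicit Types (nu : vmeasure T R l) (A B : set T).

Lemma measurable_polar_density nu i :
  measurable_fun setT (fun x => polar_density nu x i 0).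
Proof.
have := Radon_Nikodym_integrable (@vdominates_vvariation _ _ _ _ nu i).
move=> /measurable_int mf.
rewrite (_ : (fun _ => _) = fine \o ('d (nu i) '/d (vvariation nu))).
  exact: measurableT_comp.
by apply/funext => x; rewrite mxE.
Qed.

Lemma polar_density_close nu A i c e : measurable A ->
  (forall x, A x -> `|polar_density nu x i 0 - c| <= e) ->
  `|fine (nu i A) - c * fine (vvariation nu A)| <= e * fine (vvariation nu A).
Proof.
move=> mA Ae; have dom := @vdominates_vvariation _ _ _ _ nu i.
pose f x := polar_density nu x i 0.
have fE : 'd (nu i) '/d (vvariation nu) = EFin \o f.
  by apply/funext => x; rewrite /= /f mxE fineK//; exact: Radon_Nikodym_fin_num.
have If : (vvariation nu).-integrable A (EFin \o f).
  rewrite -fE; apply: integrableS (Radon_Nikodym_integrable dom) => //.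
have Ic (r : R) : (vvariation nu).-integrable A (EFin \o cst r).
  exact: finite_measure_integrable_cst.
have -> : fine (nu i A) = \int[vvariation nu]_(x in A) f x.
  by rewrite (Radon_Nikodym_integral dom mA) fE.
rewrite -!Rintegral_cst// -RintegralB//; last exact: Ic.
have If' := integrableB mA If (Ic c).
apply: le_trans (le_normr_Rintegral mA If') _.
apply: le_Rintegral => //; [exact: integrable_norm|exact: Ic].
Qed.

Lemma vvariation_eq0 nu A :
  (forall B, measurable B -> B `<=` A -> forall i, nu i B = 0%E) ->
  vvariation nu A = 0%E.
Proof.
move=> nu0; apply/eqP; rewrite eq_le vvariation_ge0 andbT.
apply/ereal_supP => _ [n [E [[mE _ EA] ->]]].
rewrite big1// => k _; rewrite (_ : vval nu (E k) = 0).
  by rewrite /enorm big1 ?sqrtr0// => i _; rewrite mxE expr0n.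
by apply/matrixP => i j; rewrite !mxE nu0//; apply: EA.
Qed.

Lemma normr_vval_le_tv nu A i : measurable A ->
  `|fine (nu i A)| <= fine (vvariation nu A).
Proof.
move=> mA; rewrite -lee_fin fineK ?fin_num_measure//.
apply: le_trans (enorm_vval_le_tv nu mA (@subset_refl _ A)); rewrite lee_fin.
rewrite -sqrtr_sqr ler_wsqrtr// (bigD1 i)//= mxE lerDl.
by rewrite sumr_ge0// => j _; rewrite sqr_ge0.
Qed.

End densities.

(** * Blow-up at an atom where the variation concentrates *)

Section blow_up.
Context (R : realType) (q l : nat) (hq : (3 <= q)%N).
Local Notation T := (path_space hq).
Implicit Types (v : seq 'I_q) (B : set T).

Let q0 : (0 < q)%N. Proof. exact: leq_trans hq. Qed.
Let qR0 : 0 < q%:R :> R. Proof. by rewrite ltr0n. Qed.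

Lemma fine_measureDI (rho : {finite_measure set T -> \bar R}) (A B : set T) :
  measurable A -> measurable B ->
  fine (rho A) = fine (rho (A `&` ~` B)) + fine (rho (A `&` B)).
Proof.
move=> mA mB; rewrite -setDE (measureDI rho mA mB) fineD ?fin_num_measure//.
  exact: measurableD.
exact: measurableI.
Qed.

(** A substitute for a differentiation theorem. If every atom failed, summing over the atoms of a
    cylinder [U] would give [eta * rho U <= rho (U \ B)], which is false when [U] is within
    [eta * rho B / 4] of [B] on both sides. *)
Lemma density_atom (rho : {finite_measure set T -> \bar R}) B (eta : R) :
  measurable B -> 0 < fine (rho B) -> 0 < eta <= 1 ->
  exists w, 0 < fine (rho (atom hq w)) /\
    fine (rho (atom hq w `&` ~` B)) <= eta * fine (rho (atom hq w)).
Proof.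
move=> mB b0 /andP[eta0 eta1]; apply: contrapT => /forallNP nw.
have mCB : measurable (~` B) by exact: measurableC.
have bad w : eta * fine (rho (atom hq w)) <= fine (rho (atom hq w `&` ~` B)).
  rewrite leNgt; apply/negP => lt; apply: (nw w); split; last exact: ltW.
  rewrite lt0r fine_ge0// andbT; apply: contraTN lt => /eqP ->.
  by rewrite mulr0 -leNgt fine_ge0.
set b := fine (rho B) in b0.
have d0 : 0 < eta * b / 4 by rewrite divr_gt0// mulr_gt0.
have rhoT : (rho setT < +oo)%E by rewrite ltey_eq fin_num_measure.
have [m0 /(_ m0 (leqnn _))[p [p1 p2]]] := cylinder_approx rhoT mB d0.
set U := cylinder _ _ in p1 p2.
have mc : measurable U by exact: measurable_cylinder.
have lt_fine (A : set T) (x : R) : measurable A -> (rho A < x%:E)%E -> fine (rho A) < x.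
  by move=> mA; rewrite -lte_fin fineK// fin_num_measure.
have {}p1 := lt_fine _ _ (measurableD mB mc) p1.
have {}p2 := lt_fine _ _ (measurableD mc mB) p2.
have atom0 (A : set T) : (atom hq [::] `&` A) = A.
  by apply/seteqP; split => [x []//|x xA]; split => //; exact: (svalP x).1.
have : eta * fine (rho U) <= fine (rho (U `&` ~` B)).
  have avgE (A : set T) : measurable A ->
      avg m0 (fun u => adens (fun X => fine (rho (X `&` A))) u * (p u)%:R) [::]
      = fine (rho (U `&` A)).
    move=> mA; have := avg_adens (charge_of_finite_measure rho) m0 p [::] mA.
    by rewrite atom0 mul1r.
  have := avgE setT measurableT; rewrite setIT => <-; rewrite -avgE// -avgZ.
  apply: le_avg => // w.
  rewrite /adens setIT mulrA ler_wpM2r ?ler0n//.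
  by rewrite mulrCA ler_wpM2l// exprn_ge0// ltW.
rewrite setDE in p1; rewrite setDE in p2.
have := fine_measureDI rho mB mc; have := fine_measureDI rho mc mB.
rewrite -/b [U `&` B]setIC => -> bE.
set x := fine (rho (U `&` ~` B)) in p2 *.
set y := fine (rho (B `&` ~` U)) in p1 bE.
have x0 : 0 <= eta * x by rewrite mulr_ge0 ?fine_ge0// ltW.
have y0 : eta * y <= eta * b / 4.
  by rewrite (le_trans _ (ltW p1))// ler_piMl// fine_ge0.
have -> : fine (rho (B `&` U)) = b - y by rewrite bE addrC addKr.
have := mulr_gt0 eta0 b0; lra.
Qed.

Lemma adensD (c1 c2 : R) (r1 r2 : set T -> R) u :
  adens (fun A => c1 * r1 A + c2 * r2 A) u = c1 * adens r1 u + c2 * adens r2 u.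
Proof. by rewrite /adens; ring. Qed.

Lemma fine_chargeDI (rho : {charge set T -> \bar R}) (A B : set T) :
  measurable A -> measurable B ->
  fine (rho A) = fine (rho (A `&` ~` B)) + fine (rho (A `&` B)).
Proof.
move=> mA mB; rewrite -setDE (chargeDI rho mA mB) fineD ?fin_num_measure//.
  exact: measurableD.
exact: measurableI.
Qed.

(** The radius [e] is chosen before [B], which later allows a countable covering by small cubes. *)
Lemma singular_cone_null (mu : probability T R) (W : {vspace 'M[R]_(l, q)})
    (nu : vmeasure T R l) (v : 'cV[R]_l) :
  uniform_measure mu -> frakW W nu -> ~ wave_cone W v ->
  exists2 e : R, 0 < e & forall B, measurable B -> mu B = 0%E ->
    (forall x, B x -> forall k, `|polar_density nu x k 0 - v k 0| <= e) ->
    vvariation nu B = 0%E.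
Proof.
move=> hmu hnu vW.
have [C C1 ell] := not_wave_cone_bound (leq_trans (leqnSn 2) hq) vW.
(* [M] is the constant demanded by [avg_le_of_small_transform]; [e] and [eta] are set so that [B]
   and its complement each contribute at most [g w / (2 * M)] to [h w]. *)
pose M : R := 64 * (C * (l * q).+1%:R).
have M64 : 64 <= M by rewrite /M ler_peMr// mulr_ege1// ler1n.
have M0 : 0 < M by rewrite (lt_le_trans _ M64).
pose e : R := (2 * M)^-1; have e0 : 0 < e by rewrite invr_gt0 mulr_gt0.
exists e => // B mB muB0 Bv.
(* Off [B], where the density is uncontrolled, [|nu k - v k * tv|] is still at most [K * tv]. *)
pose K : R := 1 + \sum_k `|v k 0|.
have K1 : 1 <= K by rewrite lerDl sumr_ge0.
have K0 : 0 < K by rewrite (lt_le_trans _ K1).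
pose eta : R := e / K; have eta0 : 0 < eta by rewrite divr_gt0.
have e128 : e <= 1 / 128.
  by rewrite /e invfM div1r -invfM lef_pV2 ?posrE; lra.
have eta128 : eta <= 1 / 128.
  by rewrite (le_trans _ e128)// ler_pdivrMr// ler_peMr// ltW.
pose tv A := fine (vvariation nu A).
have tv0 A : 0 <= tv A by rewrite fine_ge0// vvariation_ge0.
apply: contrapT => /eqP tvB0.
have tvB : 0 < tv B.
  rewrite lt0r tv0 andbT; apply: contra tvB0 => /eqP t0.
  by rewrite -(fineK (vvariation_fin_num nu B)) -/(tv B) t0.
have mCB : measurable (~` B) by exact: measurableC.
have [|w [a0 wB]] := @density_atom (vvariation nu) B eta mB tvB.
  by rewrite eta0/=; lra.
rewrite -/(tv _) in a0 wB; rewrite -/(tv _) in wB.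
pose tvc := charge_of_finite_measure (vvariation nu : {finite_measure set T -> \bar R}).
(* [g] is the martingale of [|nu|], [s k] that of the component [k] of [nu - v |nu|], and [h] that
   of a measure dominating every component. *)
pose g := adens tv.
pose hB A := e * tv (A `&` B) + K * tv (A `&` ~` B).
pose h := adens hB.
pose s k := adens (fun A : set T => 1 * fine (nu k A) + - v k 0 * tv A).
have martT (rho : {charge set T -> \bar R}) : tree_martingale (adens (fine \o rho)).
  have := adens_tree_martingale rho measurableT; congr tree_martingale.
  by apply/funext => u; rewrite /adens setIT.
have mg : tree_martingale g by exact: (martT tvc).
have mh : tree_martingale h.
  have -> : h = fun u => e * adens (fun A => tv (A `&` B)) u +
      K * adens (fun A => tv (A `&` ~` B)) u.
    by apply/funext => u; rewrite -adensD.
  apply: tree_martingaleD; first exact: (adens_tree_martingale tvc mB).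
  exact: (adens_tree_martingale tvc mCB).
have ms k : tree_martingale (s k).
  have -> : s k = fun u => 1 * adens (fine \o nu k) u + - v k 0 * g u.
    by apply/funext => u; rewrite -adensD.
  by apply: tree_martingaleD => //; exact: martT.
have mat u : measurable (atom hq u : set T) by exact: measurable_atom.
have qn0 (n : nat) : 0 < q%:R ^+ n :> R by rewrite exprn_gt0.
have sh k u : `|s k u| <= h u.
  rewrite /s /h /adens normrM ger0_norm ?(ltW (qn0 _))// ler_wpM2l ?(ltW (qn0 _))//.
  set A : set T := atom hq u.
  have mA : measurable A by exact: mat.
  have mAB : measurable (A `&` B) by exact: measurableI.
  have mACB : measurable (A `&` ~` B) by exact: measurableI.
  rewrite (fine_chargeDI (nu k) (mat u) mB).
  have -> : tv A = tv (A `&` ~` B) + tv (A `&` B).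
    exact: (fine_measureDI (vvariation nu) (mat u) mB).
  have b1 : `|fine (nu k (A `&` B)) - v k 0 * tv (A `&` B)| <= e * tv (A `&` B).
    by apply: polar_density_close => // x [_ /Bv]; exact.
  have b2 : `|fine (nu k (A `&` ~` B))| <= tv (A `&` ~` B).
    exact: normr_vval_le_tv.
  have b3 : `|v k 0 * tv (A `&` ~` B)| <= (K - 1) * tv (A `&` ~` B).
    rewrite normrM [`|tv _|]ger0_norm// ler_wpM2r// /K addrC addKr.
    by rewrite (bigD1 k)//= lerDl sumr_ge0.
  rewrite /hB; move: b1 b2 b3; rewrite !ler_norml => /andP[? ?] /andP[? ?] /andP[? ?].
  apply/andP; split; lra.
(* [D + v y^T] is the difference matrix of [nu], hence in [W], and [y] has zero sum because [g] is a
   martingale, so [ell] applies. *)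
have gs u : \sum_i (g (rcons u i) - g u) ^+ 2 <=
    C * \sum_k \sum_i (s k (rcons u i) - s k u) ^+ 2.
  pose D : 'M[R]_(l, q) := \matrix_(k, i) (s k (rcons u i) - s k u).
  pose y : 'cV[R]_q := \col_i (g (rcons u i) - g u).
  have := ell D y; under eq_bigr do rewrite mxE.
  rewrite sumrB mg sumr_const card_ord mulr_natl subrr => /(_ erefl).
  have -> : D + v *m y^T = diff_mx nu u.
    apply/matrixP => k i; rewrite !mxE big_ord1 !mxE /s !adensD /g /adens.
    by rewrite (_ : ord0 = 0)//; ring.
  move=> /(_ (hnu _ (ex_intro2 _ _ u I erefl))).
  have -> : \sum_j y j 0 ^+ 2 = \sum_i (g (rcons u i) - g u) ^+ 2.
    by apply: eq_bigr => i _; rewrite mxE.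
  suff -> : \sum_k \sum_j D k j ^+ 2 =
      \sum_k \sum_i (s k (rcons u i) - s k u) ^+ 2 by [].
  by apply: eq_bigr => k _; apply: eq_bigr => i _; rewrite mxE.
have h0 u : 0 <= h u.
  by rewrite /h /adens /hB mulr_ge0 ?(ltW (qn0 _))// addr_ge0// mulr_ge0// ltW.
have g0 u : 0 <= g u by rewrite /g /adens mulr_ge0 ?(ltW (qn0 _)).
have gw0 : 0 < g w by rewrite /g /adens mulr_gt0.
have hw : M * h w <= g w.
  rewrite /h /g /adens mulrCA ler_wpM2l ?(ltW (qn0 _))//.
  have : tv (atom hq w `&` B) <= tv (atom hq w).
    have -> : tv (atom hq w) = tv (atom hq w `&` ~` B) + tv (atom hq w `&` B).
      exact: (fine_measureDI (vvariation nu) (mat w) mB).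
    by rewrite lerDr.
  have : K * tv (atom hq w `&` ~` B) <= e * tv (atom hq w).
    have -> : e = K * eta by rewrite /eta mulrC divfK// gt_eqF.
    by rewrite -mulrA ler_wpM2l// ltW.
  have Me : M * e = 1 / 2.
    by rewrite /e invfM mulrCA mulfV ?gt_eqF// mulr1 div1r.
  rewrite /hB => k1 /(ler_wpM2l (ltW e0)) k2.
  have : M * (K * tv (atom hq w `&` ~` B) + e * tv (atom hq w `&` B)) <=
      M * (e * tv (atom hq w) + e * tv (atom hq w)).
    by rewrite ler_wpM2l ?(ltW M0)// lerD.
  rewrite -mulrDr [M * (e * _)]mulrA Me; lra.
pose n := size w.
(* One bound is relative to the uniform measure of the atom, the other to its variation;
   approximating for the sum [rho] of both measures gives a single cylinder for both. *)
pose delta : R := Num.min (q%:R ^- n / 64) (tv (atom hq w) / 64).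
have delta0 : 0 < delta by rewrite lt_min !divr_gt0 ?invr_gt0.
pose rho := measure_add (vvariation nu) mu.
have rhoT : (rho setT < +oo)%E.
  by rewrite /rho measure_addE lte_add_pinfty// ltey_eq ?fin_num_measure//
    vvariation_fin_num.
have [m /(_ (n + m)%N (leq_addl _ _))[p [p1 p2]]] :=
  cylinder_approx rhoT mB delta0.
set U := cylinder _ _ in p1 p2.
have mU : measurable (U : set T) by exact: measurable_cylinder.
have small A : measurable A -> (rho A < delta%:E)%E ->
    tv A < delta /\ fine (mu A) < delta.
  move=> mA; have -> : rho A = (tv A + fine (mu A))%:E.
    rewrite /rho measure_addE EFinD /tv.
    by rewrite !fineK ?vvariation_fin_num ?fin_num_measure.
  rewrite lte_fin => lt.
  have := tv0 A; have : 0 <= fine (mu A) by rewrite fine_ge0.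
  by split; lra.
have [{}p1 _] := small _ (measurableD mB mU) p1.
have [_ {}p2] := small _ (measurableD mU mB) p2.
have le_tv (A1 A2 : set T) : A1 `<=` A2 -> tv A1 <= tv A2.
  by move=> A12; rewrite /tv fine_le ?vvariation_fin_num// le_vvariation.
have mwB : measurable (atom hq w `&` B : set T) by exact: measurableI.
have mwU : measurable (atom hq w `&` U : set T) by exact: measurableI.
(* At most 1/128 of the variation on the atom is lost off [B] and 1/64 off [U], together below
   1/32. *)
have tvwU : tv (atom hq w) - 1 / 32 * tv (atom hq w) <= tv (atom hq w `&` U).
  have e1 : tv (atom hq w) = tv (atom hq w `&` ~` B) + tv (atom hq w `&` B).
    exact: (fine_measureDI (vvariation nu) (mat w) mB).
  have e2 : tv (atom hq w `&` B) =
      tv (atom hq w `&` B `&` ~` U) + tv (atom hq w `&` B `&` U).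
    exact: (fine_measureDI (vvariation nu) mwB mU).
  have i1 : tv (atom hq w `&` B `&` ~` U) <= tv (B `\` U).
    by apply: le_tv => x [[_ ?] ?].
  have i2 : tv (atom hq w `&` B `&` U) <= tv (atom hq w `&` U).
    by apply: le_tv => x [[? _] ?].
  have i3 : delta <= tv (atom hq w) / 64 by rewrite ge_min lexx orbT.
  have i4 : eta * tv (atom hq w) <= 1 / 128 * tv (atom hq w).
    by rewrite ler_wpM2r.
  lra.
(* [B] is [mu]-null, so [U] has the uniform measure of [U \ B], below [delta]. *)
have muwU : q%:R ^+ n * fine (mu (atom hq w `&` U)) <= 1 / 64.
  rewrite -ler_pdivlMl// mulrC div1r mulrC.
  have : fine (mu (atom hq w `&` U)) <= fine (mu (U `\` B)).
    have -> : fine (mu (U `\` B)) = fine (mu U).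
      have muUB : mu (U `&` B) = 0%E.
        by apply: subset_measure0 muB0 => //; exact: measurableI.
      have -> : fine (mu U) = fine (mu (U `&` ~` B)) + fine (mu (U `&` B)).
        exact: (fine_measureDI mu mU mB).
      by rewrite setDE muUB addr0.
    by rewrite fine_le ?fin_num_measure// le_measure ?inE.
  have : delta <= q%:R ^- n / 64 by rewrite ge_min lexx.
  lra.
have avgE (c : {charge set T -> \bar R}) :
    avg m (fun u => adens (fine \o c) u * (p u)%:R) w =
    q%:R ^+ n * fine (c (atom hq w `&` U)).
  have := avg_adens c m p w measurableT; rewrite setIT => <-.
  congr (avg m _ w); apply/funext => u.
  by rewrite /adens/= setIT.
have := avg_le_of_small_transform q0 p m mg mh ms sh C1 gs h0 g0 gw0 hw.
(* The density of [mu] is identically 1, so the average of the indicator is also a cylinder mass. *)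
rewrite (avgE tvc) (_ : (fun u => (p u)%:R) =
  fun u => adens (fine \o charge_of_finite_measure mu) u * (p u)%:R); last first.
  apply/funext => u; rewrite /adens/= (hmu u)/= mulfV ?mul1r//.
  by rewrite gt_eqF.
rewrite avgE => le1.
have le2 := ler_wpM2l (ltW gw0) muwU.
have le3 := ler_wpM2l (ltW (qn0 n)) tvwU.
have gE : g w = q%:R ^+ n * tv (atom hq w) by [].
rewrite mulrBr mulrCA -gE in le3.
have {le1} : q%:R ^+ n * tv (atom hq w `&` U) <= g w / 4 +
    9 / 8 * g w * (q%:R ^+ n * fine (mu (atom hq w `&` U))) by exact: le1.
(* The left side is at least 31/32 of [g w], the right side at most [1/4 + 9/512] of it. *)
rewrite -mulrA; lra.
Qed.

End blow_up.

(** * Countable covering of the paths whose density is outside the wave cone *)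

Theorem theorem6 (R : realType) (q l : nat)
    (hq : (3 <= q)%N) (hl : (1 <= l)%N)
    (mu : probability (path_space hq) R) (hmu : uniform_measure mu)
    (W : {vspace 'M[R]_(l, q)})
    (nu nu_abs nu_s : vmeasure (path_space hq) R l)
    (hnu : frakW W nu)
    (hdec : Lebesgue_decomposition mu nu nu_abs nu_s) :
  {ae vvariation nu_s, forall x, wave_cone W (polar_density nu x)}.
Proof.
have [decE dom [N [mN muN sN]]] := hdec.
(* [nu_abs] vanishes on measurable subsets of the [mu]-null set [N]. *)
have nusE (A : set (path_space hq)) i : measurable A -> A `<=` N ->
    nu_s i A = nu i A.
  move=> mA AN; rewrite decE//.
  have /null_content_dominatesP/(_ A mA) -> := dom i; first by rewrite add0e.
  exact: subset_measure0 muN.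
(* Preimages of rational cubes under the density, cut down to [N] so that they are [mu]-null. *)
pose ball (cr : 'cV[rat]_l * rat) : set (path_space hq) := N `&`
  \bigcap_(i in [set: 'I_l]) (fun x => polar_density nu x i 0) @^-1`
    `]ratr (cr.1 i 0) - ratr cr.2, ratr (cr.1 i 0) + ratr cr.2[.
have mball cr : measurable (ball cr).
  apply: measurableI => //; apply: fin_bigcap_measurable => // i _.
  rewrite -[X in measurable X]setTI.
  by apply: measurable_polar_density => //; exact: measurable_itv.
(* Only cubes null for the variation of [nu] are kept; every other index gives the empty set. *)
pose F k := if unpickle k is Some cr then
  if vvariation nu (ball cr) == 0%E then ball cr else set0 else set0.
have negF k : (vvariation nu_s).-negligible (F k).
  rewrite /F; case: unpickle => [cr|]; last exact: negligible_set0.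
  case: eqP => [b0|_]; last exact: negligible_set0.
  exists (ball cr); split => //; apply: vvariation_eq0 => A mA Ab i.
  rewrite nusE//; last by move=> x /Ab[].
  have /null_content_dominatesP/(_ A mA) := @vdominates_vvariation _ _ _ _ nu i.
  by apply; exact: (subset_measure0 mA (mball cr) Ab b0).
have negN : (vvariation nu_s).-negligible (~` N).
  exists (~` N); split => //; first exact: measurableC.
  by apply: vvariation_eq0 => A mA AN i; exact: sN.
apply: negligibleS (negligibleU negN (negligible_bigcup negF)) => x /= vW.
have [Nx|] := pselect (N x); last by left.
right; have [e e0 He] := singular_cone_null hmu hnu vW.
(* Values in a cube of half-side [r] differ by less than [2 * r < e], so [He] covers the whole cube
   around the density at [x]. *)
have [r /andP[r0 re]] : exists r : rat, 0 < (ratr r : R) < e / 2.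
  have /rat_in_itvoo[r] : 0 < e / 2 by rewrite divr_gt0.
  by rewrite in_itv; exists r.
have /choice[c Hc] i : exists c : rat,
    ratr c - ratr r < polar_density nu x i 0 < ratr c + ratr r.
  have /rat_in_itvoo[c] : polar_density nu x i 0 < polar_density nu x i 0 + ratr r.
    by rewrite ltrDl.
  rewrite in_itv/= => /andP[c1 c2]; exists c; apply/andP; split; lra.
pose cr : 'cV[rat]_l * rat := (\col_i c i, r).
exists (pickle cr) => //; rewrite /F pickleK.
have -> : vvariation nu (ball cr) = 0%E.
  apply: He => //; first exact: (subset_measure0 (mball cr) mN (@subIsetl _ _ _) muN).
  move=> y [_ yb] k; have := yb k I; have := Hc k; rewrite /= mxE in_itv/=.
  by move=> /andP[? ?] /andP[? ?]; rewrite ler_norml; apply/andP; split; lra.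
by rewrite eqxx; split => // i _; rewrite /= mxE in_itv/=.
Qed.
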